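(* Let $a,b$ be positive integers with $\gcd(a,b)=1$ and let $d$ be an integer with $0\leq d<ab-a-b$. Let $x_{(d)}$ be the unique integer such that $0\leq x_{(d)}<b$ and $x_{(d)}\equiv d\cdot a^{-1}\pmod b$, where $a^{-1}$ denotes an inverse of $a$ modulo $b$, and let $y_{(d)}=(d-ax_{(d)})/b$. If $y_{(d)}\geq 0$, then $d\in\mathcal C_{a,b}$; otherwise $d\notin\mathcal C_{a,b}$.
   Context: For positive integers $a,b$, define $\mathcal C_{a,b}=\{d\in\mathbb Z_{\geq 0} : d=ax+by \text{ for some } x,y\in\mathbb Z_{\geq 0}\}$. *)

(* Defs.v *)
From mathcomp Require Import all_boot all_order all_algebra.

Set Implicit Arguments.
Unset Strict Implicit.
Unset Printing Implicit Defensive.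

Import Order.TTheory GRing.Theory Num.Theory.
Local Open Scope ring_scope.

Definition in_C (a b d : int) : Prop :=
  0 <= d /\ exists x y : int, [/\ 0 <= x, 0 <= y & d = a * x + b * y].

Definition inverse_mod (b a a' : int) : Prop := (a * a' = 1 %[mod b])%Z.

(* Existence and uniqueness of such an [x], whatever the inverse [a'] of [a]
   modulo [b] used, are asserted in the theorem rather than built in here. *)
Definition is_x_ (a b d x : int) : Prop :=
  0 <= x < b /\
  exists a' : int, inverse_mod b a a' /\ (x = d * a' %[mod b])%Z.

(* The exact quotient, taken in [rat]: [%/] on [int] would round. *)
Definition y_ (a b d x : int) : rat := (d - a * x)%:Q / b%:Q.

(* Main.v *)
(* The x-coordinates of the integer solutions of d = a x + b y form a single class
   modulo b, so x_(d) is the least nonnegative one and y_(d) the largest y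
   compatible with x >= 0. *)
Require Import Defs.
From mathcomp Require Import all_boot all_order all_algebra.

Set Implicit Arguments.
Unset Strict Implicit.
Unset Printing Implicit Defensive.

Import Order.TTheory GRing.Theory Num.Theory.
Local Open Scope ring_scope.

(** Multiplying by [a] turns the condition on x_(d) into [a * x = d] modulo [b], so [d - a * x] is a
    multiple of [b]; if nonnegative, it yields a representation of [d]. Conversely, if d = a x' + b
    y' with x', y' >= 0, cancelling [a] ([eqz_modMl]) makes x_(d) the remainder of x' modulo [b], so
    a x_(d) <= a x' <= d. *)

Lemma y_ge0E (a b d x : int) : 0 < b -> (0 <= y_ a b d x) = (a * x <= d).
Proof.
by move=> b_gt0; rewrite /y_ pmulr_lge0 ?invr_gt0 ?ltr0z // ler0z subr_ge0.
Qed.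

(** The inverse [a'] cancels against [a], leaving a congruence that no longer depends on its
    choice. *)
Lemma is_x_congr (a b d x : int) : is_x_ a b d x -> (a * x = d %[mod b])%Z.
Proof.
case=> _ [a' [aa'1 x_da']].
by rewrite -modzMmr x_da' modzMmr mulrCA -modzMmr aa'1 modzMmr mulr1.
Qed.

Lemma eqz_modMl (a b x z : int) :
  coprimez b a -> (a * x = a * z %[mod b])%Z -> (x = z %[mod b])%Z.
Proof.
move=> co_ba /eqP; rewrite eqz_mod_dvd -mulrBr Gauss_dvdzr // -eqz_mod_dvd.
by move/eqP.
Qed.

Lemma inverse_mod_exists (a b : int) :
  gcdz a b = 1 -> exists a' : int, inverse_mod b a a'.
Proof.
move=> gcd_ab; have [u [v]] := Bezoutz a b; rewrite gcd_ab => uv1.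
by exists u; rewrite /inverse_mod -uv1 mulrC [in RHS]addrC modzMDl.
Qed.

Theorem mainTheorem1 (a b : int) (a_gt0 : 0 < a) (b_gt0 : 0 < b)
    (gcd_ab : gcdz a b = 1) (d : int) (d_bnd : 0 <= d < a * b - a - b) :
  (exists! x : int, is_x_ a b d x) /\
  (forall x : int, is_x_ a b d x ->
    (0 <= y_ a b d x -> in_C a b d) /\
    (~ 0 <= y_ a b d x -> ~ in_C a b d)).
Proof.
have co_ba : coprimez b a by rewrite coprimez_sym /coprimez gcd_ab.
split.
  have [a' aa'1] := inverse_mod_exists gcd_ab.
  have x_d : is_x_ a b d (d * a' %% b)%Z.
    split; first by rewrite modz_ge0 ?gt_eqF // ltz_pmod.
    by exists a'; split; last exact: modz_mod.
  exists (d * a' %% b)%Z; split=> // z z_d.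
  (* Both candidates are reduced modulo [b], so congruence gives equality, even if they come from
     different inverses. *)
  rewrite -(modz_small (proj1 x_d)) -(modz_small (proj1 z_d)).
  by apply: (eqz_modMl co_ba); rewrite (is_x_congr x_d) (is_x_congr z_d).
move=> x x_d; have [xb _] := x_d; have /andP[x_ge0 _] := xb.
have [d_ge0 _] := andP d_bnd; rewrite y_ge0E //; split=> [le_axd | gt_axd].
  split=> //; have /eqP := esym (is_x_congr x_d).
  (* The witness [k] is y_(d) as an integer. *)
  rewrite eqz_mod_dvd => /dvdzP[k dE]; exists x, k; split=> //.
    by rewrite -(pmulr_lge0 _ b_gt0) -dE subr_ge0.
  by rewrite [b * k]mulrC -dE addrC subrK.
case=> _ [x' [y' [x'_ge0 y'_ge0 dE]]]; apply: gt_axd.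
have x_mod : x = (x' %% b)%Z.
  rewrite -(modz_small xb); apply: (eqz_modMl co_ba).
  by rewrite (is_x_congr x_d) dE addrC [b * y']mulrC modzMDl.
(* Since [x'] is nonnegative, so is its quotient by [b]. *)
have le_xx' : x <= x'.
  by rewrite x_mod {2}(divz_eq x' b) lerDr mulr_ge0 ?divz_ge0 // ltW.
by rewrite dE (le_trans (ler_wpM2l (ltW a_gt0) le_xx')) // lerDl mulr_ge0 // ltW.
Qed.
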